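(* Let $h:\mathbb{R}^2\to\mathbb{R}$ be positively homogeneous and let $E^*$ be an upper exhauster of $h$ such that $h(u)=\min_{C\in E^*}H(C,u)$ for all $u\in S^1$ (the minimum being attained). Let $C_0\in E^*$. If $$\rho_{C_0}(\theta)>\rho(\theta)\quad\text{for all }\theta\in[0,2\pi],$$ then $\bar E^*=E^*\setminus\{C_0\}$ is also an upper exhauster of $h$.
   Context: A function $h:\mathbb{R}^2\to\mathbb{R}$ is positively homogeneous (of degree one) if $h(\lambda g)=\lambda h(g)$ for all $\lambda\ge 0$ and $g\in\mathbb{R}^2$. A family $E^*$ of nonempty, compact, convex subsets of $\mathbb{R}^2$ is an upper exhauster of $h$ if $h(g)=\inf_{C\in E^*}\max_{v\in C}\langle v,g\rangle$ for all $g\in\mathbb{R}^2$. The support function of a nonempty compact convex set $C$ is $H(C,u)=\max_{v\in C}\langle v,u\rangle$; $S^1$ is the set of unit vectors of $\mathbb{R}^2$. For $\theta\in[0,2\pi]$ put $u_\theta=(\cos\theta,\sin\theta)$, $\rho_C(\theta)=H(C,u_\theta)=\max_{v\in C}\langle v,u_\theta\rangle$, and $\rho(\theta)=\min_{C\in E^*}\rho_C(\theta)$ (so $\rho(\theta)=h(u_\theta)$). *)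

(* Defs.v *)
From HB Require Import structures.
From mathcomp Require Export all_boot all_order all_algebra.
From mathcomp Require Export all_classical all_reals all_analysis.
Export Order.TTheory GRing.Theory Num.Theory.
Export numFieldNormedType.Exports.

Set Implicit Arguments.
Unset Strict Implicit.
Unset Printing Implicit Defensive.

Local Open Scope classical_set_scope.
Local Open Scope ring_scope.

(** The plane is ['rV[R]_2]; its library topology is the usual one, but its
    library norm is the max norm, so the Euclidean unit circle is defined from
    the inner product. *)

Definition dot (R : realType) (u v : 'rV[R]_2) : R := \sum_(i < 2) u 0 i * v 0 i.

Definition unit_circle (R : realType) : set 'rV[R]_2 :=
  [set u | Num.sqrt (dot u u) = 1].

Definition pos_homogeneous (R : realType) (h : 'rV[R]_2 -> R) : Prop :=
  forall (lambda : R) (g : 'rV[R]_2), 0 <= lambda -> h (lambda *: g) = lambda * h g.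

Definition is_min (R : realType) (A : set R) (m : R) : Prop := A m /\ lbound A m.

(** On nonempty compact sets the [sup] is a maximum: see [support_fun_max]. *)
Definition support_fun (R : realType) (C : set 'rV[R]_2) (u : 'rV[R]_2) : R :=
  sup [set dot v u | v in C].

(** The infimum is taken in the extended reals, where that of the empty family
    is [+oo] and that of an unbounded one is [-oo]; real-valuedness of [h] thus
    excludes both. (The real-valued [inf] would return a default value.) *)
Definition upper_exhauster (R : realType) (h : 'rV[R]_2 -> R)
    (E : set (set 'rV[R]_2)) : Prop :=
  (forall C, E C -> [/\ C !=set0, compact C & convex_set C]) /\
  (forall g, (h g)%:E = ereal_inf [set (support_fun C g)%:E | C in E]).

Definition u_ (R : realType) (theta : R) : 'rV[R]_2 :=
  \row_(i < 2) if i == 0 then cos theta else sin theta.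

Definition rhoC (R : realType) (C : set 'rV[R]_2) (theta : R) : R :=
  support_fun C (u_ theta).

(** This [inf] is a minimum as soon as the minimum exists: see [rho_min]. *)
Definition rho (R : realType) (E : set (set 'rV[R]_2)) (theta : R) : R :=
  inf [set rhoC C theta | C in E].

Lemma continuous_dot (R : realType) (u : 'rV[R]_2) :
  continuous (fun v : 'rV[R]_2 => dot v u).
Proof.
apply: continuous_big => [|i _ v]; first exact: add_continuous.
by apply: continuousM; [exact: coord_continuous|exact: cst_continuous].
Qed.

Lemma support_fun_max (R : realType) (C : set 'rV[R]_2) (u : 'rV[R]_2) :
  C !=set0 -> compact C ->
  exists2 v, C v & support_fun C u = dot v u /\ forall w, C w -> dot w u <= dot v u.
Proof.
move=> C0 cC.
have [|v /set_mem Cv vmax] := @compact_EVT_max _ _ (fun v => dot v u) C C0 cC.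
  by apply: continuous_subspaceT; exact: continuous_dot.
have vM w : C w -> dot w u <= dot v u by move=> Cw; apply: vmax; exact/mem_set.
exists v => //; split => //; apply/eqP; rewrite eq_le; apply/andP; split.
  by apply: ge_sup; [exists (dot v u), v | move=> _ [w Cw <-]; exact: vM].
apply: ub_le_sup; last by exists v.
by exists (dot v u) => _ [w Cw <-]; exact: vM.
Qed.

Lemma rho_min (R : realType) (E : set (set 'rV[R]_2)) (theta m : R) :
  is_min [set rhoC C theta | C in E] m -> rho E theta = m.
Proof.
move=> [Am lbm]; apply/eqP; rewrite eq_le; apply/andP; split.
  by apply: ge_inf => //; exists m.
by apply: lb_le_inf => //; exists m.
Qed.

(* Main.v *)
Require Import Defs.
From mathcomp Require Import all_boot all_order all_algebra.
From mathcomp Require Import all_classical all_reals all_analysis.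
From mathcomp Require Import ring lra.

(** A minimizer at a direction also computes [h] on the whole ray in that
    direction, since both [h] and support functions are positively homogeneous.
    So an upper exhauster only needs, for each angle, one member attaining the
    minimum there, and polar coordinates ([polar_decomposition]) reach every
    vector of the plane, the origin included as radius [0]. The strict
    inequality says precisely that [C0] attains the minimum at no angle: the
    minimizers all survive its removal. Conversely, removing a set cannot
    lower the infimum. *)

Local Open Scope classical_set_scope.
Local Open Scope ring_scope.

Lemma dotZl (R : realType) (a : R) (u v : 'rV[R]_2) :
  dot (a *: u) v = a * dot u v.
Proof. by rewrite /dot mulr_sumr; apply: eq_bigr => i _; rewrite mxE mulrA. Qed.

Lemma dotZr (R : realType) (a : R) (u v : 'rV[R]_2) :
  dot u (a *: v) = a * dot u v.
Proof. by rewrite /dot mulr_sumr; apply: eq_bigr => i _; rewrite mxE mulrCA. Qed.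

Lemma u_unit (R : realType) (theta : R) : unit_circle (u_ theta).
Proof.
by rewrite /unit_circle /= /dot !big_ord_recl big_ord0 !mxE /= addr0 -!expr2
  cos2Dsin2 sqrtr1.
Qed.

(** Scaling the direction by a nonnegative factor scales every inner product
    alike, so a point of [C] maximal for [u] stays maximal for [a *: u]. *)
Lemma support_funZ (R : realType) (C : set 'rV[R]_2) (a : R) (u : 'rV[R]_2) :
  C !=set0 -> compact C -> 0 <= a ->
  support_fun C (a *: u) = a * support_fun C u.
Proof.
move=> C0 cC a0.
have [v Cv [-> vmax]] := support_fun_max u C0 cC.
have [w Cw [-> wmax]] := support_fun_max (a *: u) C0 cC.
apply/eqP; rewrite eq_le -dotZr wmax// andbT !dotZr.
by apply: ler_wpM2l => //; exact: vmax.
Qed.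

(** The arc cosine gives the angle on the upper half circle; its reflection
    [2 * pi - acos x] gives the lower half. *)
Lemma angle_of_unit (R : realType) (x y : R) : x ^+ 2 + y ^+ 2 = 1 ->
  exists2 theta, theta \in `[0, 2 * pi] & cos theta = x /\ sin theta = y.
Proof.
move=> xy1.
have x11 : -1 <= x <= 1 by nra.
have sin_acos_x : sin (acos x) = `|y|.
  by rewrite sin_acos// -sqrtr_sqr -xy1 addrAC subrr add0r.
have := acos_ge0 x11; have := acos_lepi x11 => acos_pi acos0.
have [y0|y0] := lerP 0 y.
  exists (acos x); first by rewrite in_itv /= acos0 /=; lra.
  by rewrite acosK ?in_itv// sin_acos_x ger0_norm.
exists (2 * pi - acos x); first by rewrite in_itv /=; lra.
have -> : 2 * pi - acos x = - acos x + pi *+ 2 by rewrite mulr_natl addrC.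
rewrite cosD2pi sinD2pi cosN sinN acosK ?in_itv// sin_acos_x ltr0_norm//.
by rewrite opprK.
Qed.

Lemma polar_decomposition (R : realType) (g : 'rV[R]_2) :
  exists r theta : R, [/\ 0 <= r, theta \in `[0, 2 * pi] & g = r *: u_ theta].
Proof.
pose r := Num.sqrt (g 0 0 ^+ 2 + g 0 1 ^+ 2).
have r0 : 0 <= r by exact: sqrtr_ge0.
have r2 : r ^+ 2 = g 0 0 ^+ 2 + g 0 1 ^+ 2.
  by rewrite sqr_sqrtr// addr_ge0// sqr_ge0.
have [theta th02pi [cosE sinE]] : exists2 theta : R, theta \in `[0, 2 * pi] &
    r * cos theta = g 0 0 /\ r * sin theta = g 0 1.
  (* At the origin the angle is arbitrary. *)
  have [rE|rN0] := eqVneq r 0.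
    exists 0; first by rewrite in_itv /= lexx mulr_ge0// pi_ge0.
    by rewrite rE !mul0r; split; nra.
  have [|theta th02pi [cosE sinE]] := @angle_of_unit R (g 0 0 / r) (g 0 1 / r).
    by rewrite !expr_div_n -mulrDl -r2 divff// expf_neq0.
  by exists theta => //; rewrite cosE sinE; split; field.
exists r, theta; split=> //; apply/rowP => i; rewrite !mxE.
case: ifPn => [/eqP ->//|i0]; rewrite sinE; congr (g 0 _).
by case: i i0 => -[|[|//]] // i2 _; exact: val_inj.
Qed.

Theorem corollary1 (R : realType) (h : 'rV[R]_2 -> R)
    (E : set (set 'rV[R]_2)) (C0 : set 'rV[R]_2)
    (h_hom : pos_homogeneous h)
    (E_exh : upper_exhauster h E)
    (h_min : forall u : 'rV[R]_2, unit_circle u -> is_min [set support_fun C u | C in E] (h u))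
    (C0_E : E C0)
    (C0_gt : forall theta : R, theta \in `[0, 2 * pi] -> rhoC C0 theta > rho E theta) :
  upper_exhauster h (E `\ C0).
Proof.
have [E_conv h_inf] := E_exh.
split=> [C [/E_conv]//|g].
apply/eqP; rewrite eq_le; apply/andP; split.
  rewrite h_inf; apply: le_ereal_inf => _ [C [EC _] <-].
  by exists C.
have [r [theta [r0 th02pi ->]]] := polar_decomposition _ g.
have u_min := h_min _ (u_unit _ theta).
have rhoE : rho E theta = h (u_ theta) by exact: rho_min.
have [[C EC CE] _] := u_min.
(* A minimizer at this angle lies below [C0] there, hence differs from it. *)
apply: ereal_inf_lbound; exists C.
  split=> // CC0; have := C0_gt _ th02pi.
  by rewrite rhoE -CE /rhoC -CC0 ltxx.
have [Cn0 cC _] := E_conv _ EC.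
by rewrite support_funZ// CE h_hom.
Qed.
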